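(* Let $n\ge 2$, let $H_1=\cdots=H_n=\mathbb{C}^2$, and let $|\varphi\rangle,|\psi\rangle\in H_1\otimes H_2\otimes\cdots\otimes H_n$ be two $W$-type states. For each $1\le k\le n$ let $\rho_k$ and $\sigma_k$ denote the $k$-th single-particle reduced density matrices of $|\varphi\rangle$ and $|\psi\rangle$, respectively. If for every $1\le k\le n$ the matrices $\rho_k$ and $\sigma_k$ have the same spectrum (eigenvalues counted with multiplicity), then $|\varphi\rangle$ and $|\psi\rangle$ are LU equivalent. That is, a multi-partite $W$-type state is determined, up to local unitaries, by its single-particle reduced density matrices.
   Context: Let $\{|0\rangle,|1\rangle\}$ be the standard orthonormal basis of $\mathbb{C}^2$, and write $|i_1 i_2\cdots i_n\rangle=|i_1\rangle\otimes\cdots\otimes|i_n\rangle$. A (pure) state is a unit vector. The $n$-partite $W$ state is $|W\rangle_n=\frac{1}{\sqrt n}\left(|0\cdots 01\rangle+|0\cdots 010\rangle+\cdots+|10\cdots 0\rangle\right)$, i.e. the normalized sum of the $n$ basis vectors having exactly one entry equal to $1$. A $W$-type state is a pure state in $(\mathbb{C}^2)^{\otimes n}$ that is SLOCC equivalent to $|W\rangle_n$, i.e. a unit vector of the form $(A_1\otimes A_2\otimes\cdots\otimes A_n)|W\rangle_n$ with every $A_k$ a nonsingular complex $2\times 2$ matrix. The $k$-th single-particle reduced density matrix of a state $|\varphi\rangle$ is the $2\times 2$ matrix obtained from $|\varphi\rangle\langle\varphi|$ by taking the partial trace over all tensor factors $H_j$ with $j\ne k$. Two states $|\varphi\rangle,|\psi\rangle$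 are LU equivalent if there exist $2\times 2$ unitary matrices $U_1,\dots,U_n$ such that $|\varphi\rangle=(U_1\otimes\cdots\otimes U_n)|\psi\rangle$. *)

(* Defs.v *)
From HB Require Import structures.
From mathcomp Require Import all_boot all_order all_algebra.

Set Implicit Arguments.
Unset Strict Implicit.
Unset Printing Implicit Defensive.

Import Order.TTheory GRing.Theory Num.Theory.
Local Open Scope ring_scope.

(* The n-tuple i = (i_1, ..., i_n) of bits labels the basis vector |i_1...i_n>. *)
Definition qindex (n : nat) := {ffun 'I_n -> 'I_2}.

(* A vector of (C^2)^{(x) n} is given by its coordinates phi i = <i|phi> in the
   computational basis. *)
Definition qvector (C : numClosedFieldType) (n : nat) := {ffun qindex n -> C}.

Definition is_state (C : numClosedFieldType) (n : nat) (phi : qvector C n) :=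
  \sum_i `|phi i| ^+ 2 = 1.

(* (A_1 (x) ... (x) A_n) phi: the (i, j) entry of the Kronecker product is
   A_1(i_1, j_1) ... A_n(i_n, j_n). *)
Definition local_op (C : numClosedFieldType) (n : nat) (A : 'I_n -> 'M[C]_2)
    (phi : qvector C n) : qvector C n :=
  [ffun i : qindex n =>
     \sum_(j : qindex n) (\prod_(k < n) A k (i k) (j k)) * phi j].

Definition W_state (C : numClosedFieldType) (n : nat) : qvector C n :=
  [ffun i : qindex n =>
     (sqrtC n%:R)^-1 * (#|[set k | i k == 1]| == 1%N)%:R].

Definition SLOCC_equiv (C : numClosedFieldType) (n : nat)
    (phi psi : qvector C n) :=
  exists A : 'I_n -> 'M[C]_2,
    (forall k, A k \in unitmx) /\ phi = local_op A psi.

Definition LU_equiv (C : numClosedFieldType) (n : nat)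
    (phi psi : qvector C n) :=
  exists U : 'I_n -> 'M[C]_2,
    (forall k, U k \is unitarymx) /\ phi = local_op U psi.

Definition W_type (C : numClosedFieldType) (n : nat) (phi : qvector C n) :=
  is_state phi /\ SLOCC_equiv phi (W_state C n).

(* Entries <i|phi><phi|j> of |phi><phi|. *)
Definition density (C : numClosedFieldType) (n : nat) (phi : qvector C n)
    (i j : qindex n) : C := phi i * (phi j)^*.

(* Partial trace over all tensor factors other than the k-th of the operator
   with entries M i j: the indices i and j are identified off k. *)
Definition partial_trace (C : numClosedFieldType) (n : nat) (k : 'I_n)
    (M : qindex n -> qindex n -> C) : 'M[C]_2 :=
  \matrix_(a, b)
    \sum_(i : qindex n | i k == a)
      \sum_(j : qindex n | (j k == b) && [forall l, (l != k) ==> (i l == j l)])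
        M i j.

Definition reduced_density (C : numClosedFieldType) (n : nat)
    (phi : qvector C n) (k : 'I_n) : 'M[C]_2 := partial_trace k (density phi).

(* Each scalar is an eigenvalue of A and B with the same algebraic multiplicity;
   multiplicity 0 means that it is not an eigenvalue. *)
Definition same_spectrum (C : numClosedFieldType) (m : nat) (A B : 'M[C]_m) :=
  forall x : C, mup x (char_poly A) = mup x (char_poly B).

(* Main.v *)
Require Import Defs.
From mathcomp Require Import all_boot all_order all_algebra all_fingroup.
From mathcomp Require Import reals complex.
From mathcomp Require Import ring lra.

Set Implicit Arguments.
Unset Strict Implicit.
Unset Printing Implicit Defensive.

Import Order.TTheory GRing.Theory Num.Theory.
Local Open Scope ring_scope.
Local Open Scope sesquilinear_scope.

(** QR factorization of each A_k, followed by diagonal unitaries, makes a W-type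
    state LU equivalent to y_0 |0...0> + y_1 |e_1> + ... + y_n |e_n> with
    y_0 >= 0 and y_k > 0, where e_k has its only 1 in position k.  Writing
    p_k = y_k^2 and S = p_1 + ... + p_n, the k-th reduced density matrix has
    determinant p_k (S - p_k) and trace y_0^2 + S.  So it suffices to show that,
    for n >= 3, positive p_k are determined by the numbers d_k = p_k (S - p_k).

    Let q, with sum T >= S, give the same d.  The smaller root of x (s - x) = d_k
    decreases with s.  If no q_k exceeds T / 2, then q <= p, hence q = p.
    Otherwise q_k > T / 2 for one k, so d_k is the largest of the d_j, and then
    p_j and q_j are the smaller roots for all j <> k.  If S = T this gives p = q.
    If S < T, then p_j / q_j is smaller than the ratio of the sums of the p_l and
    of the q_l over l <> k, for all j <> k, which is impossible.

    For n = 2 the sum S is not determined; instead, the reduced density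
    matrix M M' (M' the adjoint) determines the invertible coefficient matrix M
    up to a unitary factor on the right. *)

(** * Recovering positive reals from the numbers p_k (S - p_k) *)

(** If [p < q], then [p * (s - p) <= p * (t - p) < q * (t - q)], because [x * (t - x)] increases
    strictly up to [t / 2]. The strict variant below swaps the two kinds of inequality. *)
Lemma small_root_le (R : realFieldType) (s t p q : R) :
  0 < p -> s <= t -> q *+ 2 <= t -> p * (s - p) = q * (t - q) -> q <= p.
Proof. by move=> p0 st qt e; rewrite leNgt; apply/negP => pq; nra. Qed.

Lemma small_root_lt (R : realFieldType) (s t p q : R) :
  0 < p -> s < t -> q *+ 2 <= t -> p * (s - p) = q * (t - q) -> q < p.
Proof. by move=> p0 st qt e; rewrite ltNge; apply/negP => pq; nra. Qed.

(* With r = p / q and r' = p' / q', eliminating s and t gives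
   (r' - r) (t - q (r r' + 1)) = (q' - q) r (r'^2 - 1). *)
Lemma small_root_ratio (R : realFieldType) (s t p q p' q' : R) :
  0 < p -> 0 < q -> q < q' -> q' < p' -> p *+ 2 < s ->
  p * (s - p) = q * (t - q) -> p' * (s - p') = q' * (t - q') ->
  p * q' < p' * q.
Proof.
move=> p0 q0 qq' qp' ps e e'; rewrite ltNge; apply/negP => le.
have q'0 : 0 < q' by lra.
have id : (p' * q - p * q') * (t * q' - p * p' - q * q') =
          (q' - q) * (p * (p' ^+ 2 - q' ^+ 2)).
  apply/eqP; rewrite -subr_eq0; apply/eqP.
  transitivity (p * q' * (p' * (s - p') - q' * (t - q')) -
                p' * q' * (p * (s - p) - q * (t - q))); first ring.
  by rewrite e e' !subrr !mulr0 subrr.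
(* Under the negated conclusion [le], the second factor on the left of [id] is positive, and so is
   the right side. Hence the first factor is positive too, against [le]. *)
have pos : 0 < q * (t * q' - p * p' - q * q').
  have -> : q * (t * q' - p * p' - q * q') =
            p * (q' * (s - p *+ 2) + (p * q' - p' * q)) by
    transitivity (q' * (q * (t - q)) - q * (p * p')); [ring | rewrite -e; ring].
  rewrite mulr_gt0 // ltr_wpDr ?subr_ge0 // mulr_gt0 ?subr_gt0 //.
have rhs : 0 < (q' - q) * (p * (p' ^+ 2 - q' ^+ 2)).
  by rewrite !mulr_gt0 ?subr_gt0 // ltr_pXn2r // ?nnegrE; lra.
move: pos rhs; rewrite -id pmulr_rgt0 // => pos.
by rewrite pmulr_lgt0 // subr_gt0 ltNge le.
Qed.

(** A third index contributes a positive term; for [n = 2] there would be equality. This is where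
    [n >= 3] enters. *)
Lemma ltr_sum_third (R : realFieldType) (n : nat) (p : 'I_n -> R) (j k : 'I_n) :
  (2 < n)%N -> (forall l, 0 < p l) -> j != k -> p j + p k < \sum_l p l.
Proof.
move=> n2 p0 jk.
have [l] : exists l, l \notin [set j; k].
  apply/existsP; rewrite -negb_forall; apply/negP => /forallP h.
  have : #|[set: 'I_n]| = n by rewrite cardsT card_ord.
  have -> : [set: 'I_n] = [set j; k] by apply/setP => l; rewrite h inE.
  by rewrite cards2 jk => e; rewrite -e in n2.
rewrite !inE negb_or => /andP[lj lk].
rewrite (bigD1 j) //= (bigD1 k) 1?eq_sym //= (bigD1 l) ?lj ?lk //=.
rewrite addrA ltrDl ltr_wpDr // sumr_ge0 // => i _; exact: ltW.
Qed.

Lemma sum_complement_inj_le (R : realFieldType) (n : nat) (p q : 'I_n -> R) :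
  (2 < n)%N -> (forall k, 0 < p k) -> (forall k, 0 < q k) ->
  (forall k, p k * (\sum_l p l - p k) = q k * (\sum_l q l - q k)) ->
  \sum_l p l <= \sum_l q l -> p =1 q.
Proof.
move=> n2 p0 q0 e; set s := \sum_l p l; set t := \sum_l q l => st.
have [/forallP small k|] := boolP [forall k, q k *+ 2 <= t].
  have qp j : q j <= p j.
    exact: small_root_le (p0 j) st (small j) (e j).
  (* Summing [q <= p] gives [t <= s], so the sums agree and nonnegative differences add up to
     zero. *)
  have z : \sum_l (p l - q l) = 0.
    apply/eqP; rewrite sumrB subr_eq0 eq_le st /=.
    by apply: ler_sum => j _.
  apply/eqP; rewrite -subr_eq0; apply/eqP.
  by apply: (psumr_eq0P _ z) => // j _; rewrite subr_ge0.
rewrite negb_forall => /existsP[k]; rewrite -ltNge => qk.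
have sumk (f : 'I_n -> R) : \sum_(j | j != k) f j = \sum_l f l - f k.
  by rewrite [in RHS](bigD1 k) //= addrC addrK.
have qj j : j != k -> q j + q k < t by exact: ltr_sum_third.
(* Here [q j < t - q k < q k] makes [d_j < d_k]. If [p j] were at least [s / 2], then
   [p k < s - p j <= p j] would give [d_k < d_j] instead. *)
have pj j : j != k -> p j *+ 2 < s.
  move=> jk; rewrite ltNge; apply/negP => le.
  have pjk : p j + p k < s by exact: ltr_sum_third.
  have := qj j jk; have := e j; have := e k; rewrite -/s -/t => ek ej qjk.
  have : q j * (t - q j) < q k * (t - q k) by rewrite -subr_gt0; nra.
  by rewrite -ek -ej; nra.
have [ts|lt] := leP t s.
  have pq j : j != k -> p j = q j.
    move=> jk; apply/eqP; rewrite eq_le; apply/andP; split.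
      exact: small_root_le (q0 j) ts (ltW (pj j jk)) (esym (e j)).
    by apply: small_root_le (p0 j) st _ (e j); have := qj j jk; lra.
  have pqk : p k = q k.
    have : s - p k = t - q k by rewrite -!sumk; apply: eq_bigr => j /pq.
    by have -> : t = s; [apply/eqP; rewrite eq_le ts | lra].
  by move=> j; have [->|/pq] := eqVneq j k.
have qp j : j != k -> q j < p j.
  by move=> jk; apply: small_root_lt (p0 j) lt _ (e j); have := qj j jk; lra.
have [j jk] : exists j, j != k.
  have [k0|k0] := eqVneq k (Ordinal (ltnW (ltnW n2))).
    by exists (Ordinal (ltnW n2)); rewrite k0.
  by exists (Ordinal (ltnW (ltnW n2))); rewrite eq_sym.
have strict (f g : 'I_n -> R) : (forall i, i != k -> f i < g i) ->
    \sum_(i | i != k) f i < \sum_(i | i != k) g i.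
  move=> fg; rewrite (bigD1 j) //= [ltRHS](bigD1 j) //=.
  by rewrite ltr_leD ?fg // ler_sum // => i /andP[/fg/ltW].
have QP := strict _ _ qp; rewrite !sumk -/s -/t in QP.
(* The ratio lemma is used with [q' = t - q k] and [p' = s - p k], the complementary roots of the
   two equations for [k]. These are also the sums over all indices other than [k], so summing over
   [i != k] gives the same product on both sides, a contradiction. *)
have ratio i : i != k -> p i * (t - q k) < (s - p k) * q i.
  move=> ik; apply: (small_root_ratio (p0 i) (q0 i) _ QP (pj i ik) (e i)).
    by have := qj i ik; lra.
  by have := e k; rewrite -/s -/t; lra.
have := strict _ _ ratio.
by rewrite -mulr_suml -mulr_sumr !sumk ltxx.
Qed.

Lemma sum_complement_inj (R : realFieldType) (n : nat) (p q : 'I_n -> R) :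
  (2 < n)%N -> (forall k, 0 < p k) -> (forall k, 0 < q k) ->
  (forall k, p k * (\sum_l p l - p k) = q k * (\sum_l q l - q k)) ->
  p =1 q.
Proof.
move=> n2 p0 q0 e; have [le|/ltW le] := leP (\sum_l p l) (\sum_l q l).
  exact: sum_complement_inj_le.
by move=> k; apply/esym/sum_complement_inj_le => // l; rewrite e.
Qed.

(** * Spectra and unitary similarity, with 2 x 2 determinants and traces *)

Lemma same_spectrum_char_poly (C : numClosedFieldType) (m : nat)
    (A B : 'M[C]_m) :
  same_spectrum A B -> char_poly A = char_poly B.
Proof.
move=> AB; have [r rE] := closed_field_poly_normal (char_poly A).
have [s sE] := closed_field_poly_normal (char_poly B).
move: rE sE; rewrite !(monicP (char_poly_monic _)) !scale1r => rE sE.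
rewrite rE sE; apply: perm_big; apply/allP => x _ /=.
by have := AB x; rewrite rE sE !mu_prod_XsubC => ->.
Qed.

Lemma char_poly_conjumx (F : fieldType) (m : nat) (P A : 'M[F]_m) :
  P \in unitmx -> char_poly (P *m A *m invmx P) = char_poly A.
Proof.
move=> Pu; rewrite /char_poly.
have -> : char_poly_mx (P *m A *m invmx P) =
    map_mx polyC P *m char_poly_mx A *m map_mx polyC (invmx P).
  rewrite /char_poly_mx mulmxBr mulmxBl !map_mxM; congr (_ - _).
  by rewrite scalar_mxC -mulmxA -map_mxM mulmxV // map_mx1 mulmx1.
rewrite !det_mulmx mulrAC -det_mulmx -map_mxM mulmxV //.
by rewrite map_mx1 det1 mul1r.
Qed.

(** The spectral theorem diagonalizes both matrices unitarily. Equal characteristic polynomials make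
    the two diagonals agree up to a permutation [s], and its permutation matrix is unitary. *)
Lemma normalmx_same_spectrum (C : numClosedFieldType) (m : nat)
    (A B : 'M[C]_m) :
  A \is normalmx -> B \is normalmx -> same_spectrum A B ->
  exists2 U : 'M[C]_m, U \is unitarymx & A = U *m B *m U^t*.
Proof.
move=> /orthomx_spectralP; move: (spectralmx A) (spectral_diag A)
  (spectral_unitarymx A) => P a Pu AE.
move=> /orthomx_spectralP; move: (spectralmx B) (spectral_diag B)
  (spectral_unitarymx B) => Q b Qu BE.
have charE (M N : 'M[C]_m) d : N \is unitarymx ->
    M = invmx N *m diag_mx d *m N ->
    char_poly M = \prod_(x <- [tuple d 0 i | i < m]) ('X - x%:P).
  move=> Nu ->.
  have {2}-> : N = invmx (invmx N) by rewrite invmxK.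
  rewrite char_poly_conjumx ?unitmx_inv ?unitarymx_unit //.
  rewrite char_poly_trig ?diag_mx_is_trig // big_tuple.
  by apply: eq_bigr => i _; rewrite tnth_mktuple mxE eqxx.
move=> /same_spectrum_char_poly.
rewrite (charE _ _ _ Pu AE) (charE _ _ _ Qu BE).
move=> /prod_XsubC_eq/tuple_permP[s /val_inj sE].
have ab i : a 0 i = b 0 (s i).
  have := congr1 (fun t => tnth t i) sE.
  by rewrite !tnth_mktuple.
have su : (perm_mx s : 'M[C]_m) \is unitarymx.
  apply/unitarymxP; rewrite tr_perm_mx map_perm_mx -perm_mxM.
  by rewrite mulgV perm_mx1.
exists (P^t* *m perm_mx s *m Q).
  by rewrite !mul_unitarymx // trmxC_unitary.
have diagE : diag_mx a = perm_mx s *m diag_mx b *m (perm_mx s)^t*.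
  rewrite tr_perm_mx map_perm_mx.
  rewrite -row_permE -col_permE; apply/matrixP => i j.
  by rewrite !mxE ab (inj_eq perm_inj).
rewrite AE BE diagE !invmx_unitary // !trmx_mul !map_mxM trmxCK !mulmxA.
by rewrite !(mulmxtVK _ Qu).
Qed.

Lemma det_mx22 (R : comNzRingType) (A : 'M[R]_2) :
  \det A = A 0 0 * A 1 1 - A 0 1 * A 1 0.
Proof.
rewrite (expand_det_row _ ord0) !big_ord_recl big_ord0 addr0.
rewrite /cofactor !det_mx11 !mxE /=.
rewrite expr0 expr1 mul1r mulN1r mulrN.
have e1 : lift ord0 ord0 = 1 :> 'I_2 by exact: val_inj.
have e2 : lift (lift ord0 ord0) 0 = 0 :> 'I_2 by exact: val_inj.
by rewrite e2 e1.
Qed.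

Lemma tr_mx22 (R : nzRingType) (A : 'M[R]_2) : \tr A = A 0 0 + A 1 1.
Proof.
rewrite /mxtrace !big_ord_recl big_ord0 addr0.
by have -> : lift ord0 ord0 = 1 :> 'I_2 by exact: val_inj.
Qed.

(** * Local operators and LU equivalence *)

Lemma local_op_comp (C : numClosedFieldType) (n : nat) (A B : 'I_n -> 'M[C]_2)
    (phi : qvector C n) :
  local_op A (local_op B phi) = local_op (fun k => A k *m B k) phi.
Proof.
apply/ffunP => i; rewrite !ffunE.
under eq_bigr => j _ do rewrite ffunE mulr_sumr.
rewrite exchange_big; apply: eq_bigr => l _ /=.
under eq_bigr => j _ do rewrite mulrA -big_split /=.
rewrite -mulr_suml; congr (_ * _).
(* A sum over all index tuples of a product is the product of the sums over the single entries. *)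
rewrite -(bigA_distr_bigA (fun k b => A k (i k) b * B k b (l k))).
by apply: eq_bigr => k _; rewrite mxE.
Qed.

Lemma prodr_eq_indicator (R : comPzSemiRingType) (n : nat) (i j : qindex n) :
  \prod_k (i k == j k)%:R = (i == j)%:R :> R.
Proof.
have [->|] := eqVneq i j; first by rewrite big1 // => k _; rewrite eqxx.
move/eqP => ij; have [/forallP e|] := boolP [forall k, i k == j k].
  by case: ij; apply/ffunP => k; apply/eqP.
by rewrite negb_forall => /existsP[k /negPf e]; rewrite (bigD1 k) //= e mul0r.
Qed.

Lemma local_op1 (C : numClosedFieldType) (n : nat) (phi : qvector C n) :
  local_op (fun=> 1%:M) phi = phi.
Proof.
apply/ffunP => i; rewrite ffunE.
under eq_bigr => j _.
  under eq_bigr do rewrite mxE.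
  rewrite prodr_eq_indicator; over.
rewrite (bigD1 i) //= eqxx mul1r big1 ?addr0 // => j ji.
by rewrite eq_sym (negPf ji) mul0r.
Qed.

Lemma eq_local_op (C : numClosedFieldType) (n : nat) (A B : 'I_n -> 'M[C]_2)
    (phi : qvector C n) : A =1 B -> local_op A phi = local_op B phi.
Proof.
move=> AB; apply/ffunP => i; rewrite !ffunE; apply: eq_bigr => j _.
by congr (_ * _); apply: eq_bigr => k _; rewrite AB.
Qed.

Lemma LU_equiv_trans (C : numClosedFieldType) (n : nat)
    (phi psi chi : qvector C n) :
  LU_equiv phi psi -> LU_equiv psi chi -> LU_equiv phi chi.
Proof.
move=> [U [Uu ->]] [V [Vu ->]]; exists (fun k => U k *m V k).
by split=> [k|]; rewrite ?mul_unitarymx ?local_op_comp.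
Qed.

Lemma LU_equiv_sym (C : numClosedFieldType) (n : nat) (phi psi : qvector C n) :
  LU_equiv phi psi -> LU_equiv psi phi.
Proof.
move=> [U [Uu ->]]; exists (fun k => (U k)^t*); split=> [k|].
  by rewrite trmxC_unitary.
rewrite local_op_comp -[LHS]local_op1; apply: eq_local_op => k.
by rewrite -invmx_unitary // mulVmx // unitarymx_unit.
Qed.

(** * Reduced density matrices under local operators *)

(* Taking G k = 1 traces out the k-th factor, and G k = delta_mx a b extracts the
   (a, b) entry of the k-th factor. *)
Definition sandwich (C : numClosedFieldType) (n : nat) (phi : qvector C n)
    (G : 'I_n -> 'M[C]_2) : C :=
  \sum_(i : qindex n) \sum_(j : qindex n)
    (\prod_k G k (i k) (j k)) * (phi i * (phi j)^*).

Lemma eq_sandwich (C : numClosedFieldType) (n : nat) (phi : qvector C n)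
    (G H : 'I_n -> 'M[C]_2) : G =1 H -> sandwich phi G = sandwich phi H.
Proof.
move=> GH; apply: eq_bigr => i _; apply: eq_bigr => j _.
by congr (_ * _); apply: eq_bigr => k _; rewrite GH.
Qed.

(** The operators move from the state to the test matrices [G k] factor by factor, once the sums
    over [i] and [j] are brought inside those over the indices [i'] and [j'] of [phi]. *)
Lemma sandwich_local_op (C : numClosedFieldType) (n : nat)
    (A : 'I_n -> 'M[C]_2) (phi : qvector C n) (G : 'I_n -> 'M[C]_2) :
  sandwich (local_op A phi) G =
  sandwich phi (fun k => (A k)^T *m G k *m map_mx Num.conj (A k)).
Proof.
rewrite /sandwich.
transitivity (\sum_(i : qindex n) \sum_(j : qindex n)
  \sum_(i' : qindex n) \sum_(j' : qindex n)
  (\prod_k (A k (i k) (i' k) * (G k (i k) (j k)) * (A k (j k) (j' k))^*)) *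
  (phi i' * (phi j')^*)).
  apply: eq_bigr => i _; apply: eq_bigr => j _; rewrite !ffunE rmorph_sum.
  rewrite mulr_suml mulr_sumr; apply: eq_bigr => i' _.
  rewrite !mulr_sumr; apply: eq_bigr => j' _.
  by rewrite !big_split /= rmorphM rmorph_prod; ring.
under eq_bigr do rewrite exchange_big.
rewrite exchange_big; apply: eq_bigr => i' _ /=.
under eq_bigr do rewrite exchange_big.
rewrite exchange_big; apply: eq_bigr => j' _ /=.
under eq_bigr do rewrite -mulr_suml.
rewrite -mulr_suml; congr (_ * _).
transitivity (\sum_(i : qindex n) \prod_k \sum_b
    A k (i k) (i' k) * G k (i k) b * (A k b (j' k))^*).
  by apply: eq_bigr => i _; rewrite bigA_distr_bigA.
rewrite -(bigA_distr_bigA (fun k c => \sum_b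
  A k c (i' k) * G k c b * (A k b (j' k))^*)).
apply: eq_bigr => k _; rewrite exchange_big mxE; apply: eq_bigr => b _ /=.
by rewrite !mxE mulr_suml; apply: eq_bigr => c _; rewrite !mxE.
Qed.

Lemma reduced_densityE (C : numClosedFieldType) (n : nat) (phi : qvector C n)
    (k : 'I_n) (a b : 'I_2) :
  reduced_density phi k a b =
  sandwich phi (fun l => if l == k then delta_mx a b else 1%:M).
Proof.
rewrite mxE big_mkcond; apply: eq_bigr => i _.
case: ifP => [ik|ik]; last first.
  by rewrite big1 // => j _; rewrite (bigD1 k) //= eqxx mxE ik !mul0r.
rewrite big_mkcond; apply: eq_bigr => j _.
rewrite (bigD1 k) //= eqxx mxE ik /=.
have [jk|] := eqVneq (j k) b; last by rewrite !mul0r.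
rewrite mul1r; have [/forallP e|] := boolP
  [forall l, (l != k) ==> (i l == j l)].
  rewrite big1 ?mul1r // => l lk; have := e l.
  by rewrite lk /= => /eqP->; rewrite (negPf lk) mxE eqxx.
rewrite negb_forall => /existsP[l]; rewrite negb_imply => /andP[lk il].
by rewrite (bigD1 l) //= (negPf lk) mxE (negPf il) !mul0r.
Qed.

Lemma reduced_density_local_unitary (C : numClosedFieldType) (n : nat)
    (U : 'I_n -> 'M[C]_2) (phi : qvector C n) (k : 'I_n) :
  (forall l, U l \is unitarymx) ->
  reduced_density (local_op U phi) k =
  U k *m reduced_density phi k *m (U k)^t*.
Proof.
move=> Uu; apply/matrixP => a b.
rewrite reduced_densityE sandwich_local_op.
(* Off [k] the moved factors cancel by unitarity, so only the [k]-th test matrix changes; [Hk]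
   expands it in the matrix units [delta_mx c d]. *)
pose H l : 'M[C]_2 :=
  if l == k then (U k)^T *m delta_mx a b *m map_mx Num.conj (U k) else 1%:M.
have -> : sandwich phi (fun l => (U l)^T *m (if l == k then delta_mx a b
    else 1%:M) *m map_mx Num.conj (U l)) = sandwich phi H.
  apply: eq_sandwich => l; rewrite /H; case: eqP => [->//|_].
  rewrite mulmx1; apply: (can_inj (@trmxK _ _ _)).
  rewrite trmx_mul trmxK trmx1 map_trmx.
  by rewrite -invmx_unitary // mulVmx // unitarymx_unit.
have Hk i j : H k i j = \sum_d \sum_c U k a c * (U k b d)^* * delta_mx c d i j.
  rewrite /H eqxx (bigD1 j) //= (bigD1 i) //= !mxE !eqxx mulr1.
  rewrite [X in _ + X + _]big1 ?addr0 => [|c ci]; last first.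
    by rewrite mxE eq_sym (negPf ci) mulr0.
  rewrite [X in _ = _ + X]big1 ?addr0 => [|d dj]; last first.
    by rewrite big1 // => c _; rewrite mxE [j == _]eq_sym (negPf dj) andbF mulr0.
  rewrite (bigD1 b) //= [X in _ + X]big1 ?addr0 => [|d db]; last first.
    rewrite mxE big1 ?mul0r // => c _.
    by rewrite !mxE (negPf db) andbF mulr0.
  rewrite !mxE (bigD1 a) //= big1 ?addr0 ?mxE ?eqxx ?mulr1 // => c ca.
  by rewrite !mxE (negPf ca) mulr0.
transitivity (\sum_d \sum_c U k a c * (U k b d)^* * reduced_density phi k c d).
  under [RHS]eq_bigr => d _ do under eq_bigr => c _ do
    rewrite reduced_densityE mulr_sumr.
  under [RHS]eq_bigr => d _ do rewrite exchange_big.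
  rewrite [RHS]exchange_big; apply: eq_bigr => i _ /=.
  under [RHS]eq_bigr => d _ do under eq_bigr => c _ do rewrite mulr_sumr.
  under [RHS]eq_bigr => d _ do rewrite exchange_big.
  rewrite [RHS]exchange_big; apply: eq_bigr => j _ /=.
  rewrite (bigD1 k) //= Hk !mulr_suml; apply: eq_bigr => d _.
  rewrite !mulr_suml; apply: eq_bigr => c _.
  rewrite [in RHS](bigD1 k) //= eqxx !mulrA; congr (_ * _ * _ * _).
  by apply: eq_bigr => l /negPf lk; rewrite /H lk.
rewrite mxE; apply: eq_bigr => d _; rewrite !mxE mulr_suml.
by apply: eq_bigr => c _; rewrite mulrAC.
Qed.

(** * Superpositions of |0...0> and the e_k, and the LU normal form *)

Lemma big_option (R : Type) (idx : R) (op : Monoid.com_law idx) (I : finType)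
    (F : option I -> R) :
  \big[op/idx]_o F o = op (F None) (\big[op/idx]_i F (Some i)).
Proof.
rewrite (bigD1 None) //=; congr (op _ _).
rewrite (reindex_omap Some id) //=; last by case.
by apply: eq_bigl => i; rewrite eqxx.
Qed.

(* |0...0> for None, and the basis vector whose only 1 is in position k for
   Some k. *)
Definition wbasis (n : nat) (o : option 'I_n) : qindex n :=
  [ffun l => if o == Some l then 1 else 0].

Definition wvec (C : numClosedFieldType) (n : nat) (y : option 'I_n -> C) :
    qvector C n :=
  [ffun i => \sum_o y o * (i == wbasis o)%:R].

Lemma ord2_case (a : 'I_2) : a = 0 \/ a = 1.
Proof. by case: a => [[|[|a]]] // lt; [left|right]; exact: val_inj. Qed.

Lemma wbasis_inj n : injective (@wbasis n).
Proof.
move=> [k|] [l|] // /ffunP e; last 2 first.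
- by have := e k; rewrite !ffunE eqxx.
- by have := e l; rewrite !ffunE eqxx.
by have := e k; rewrite !ffunE eqxx; case: eqP => // -[->].
Qed.

Lemma W_state_wvec (C : numClosedFieldType) (n : nat) :
  W_state C n = wvec (fun o => if o is Some _ then (sqrtC n%:R)^-1 else 0).
Proof.
apply/ffunP => i; rewrite !ffunE big_option /= mul0r add0r -mulr_sumr.
congr (_ * _); have [/cards1P[k kE]|ne1] := boolP (_ == _).
  have ik : i = wbasis (Some k).
    apply/ffunP => l; rewrite ffunE (inj_eq (@Some_inj _)) eq_sym.
    by rewrite -in_set1 -kE inE; case: (ord2_case (i l)) => ->.
  rewrite (bigD1 k) //= {1}ik eqxx big1 ?addr0 // => l lk.
  rewrite ik (inj_eq (@wbasis_inj n)); case: eqP => // -[kl].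
  by rewrite kl eqxx in lk.
rewrite big1 // => k _; case: eqP => // ik; case/negP: ne1.
apply/cards1P; exists k; apply/setP => l; rewrite !inE ik ffunE.
by rewrite (inj_eq (@Some_inj _)) [l == k]eq_sym; case: (k == l).
Qed.

(** An upper triangular factor sends |0> to a multiple of |0> and |1> to a combination of |0> and
    |1>. So no second 1 can arise, and the upper right entries only feed the coefficient of
    |0...0>. *)
Lemma local_op_triangular_wvec (C : numClosedFieldType) (n : nat)
    (T : 'I_n -> 'M[C]_2) (y : option 'I_n -> C) :
  (forall l, T l 1 0 = 0) ->
  local_op T (wvec y) = wvec (fun o =>
    if o is Some k then y o * (T k 1 1 * \prod_(l | l != k) T l 0 0)
    else y None * \prod_l T l 0 0 +
         \sum_k y (Some k) * (T k 0 1 * \prod_(l | l != k) T l 0 0)).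
Proof.
move=> T0; apply/ffunP => i; rewrite !ffunE.
have wE (k l : 'I_n) : l != k -> wbasis (Some k) l = wbasis None l.
  by move=> lk; rewrite !ffunE (inj_eq (@Some_inj _)) eq_sym (negPf lk).
have wk (k : 'I_n) : wbasis (Some k) k = 1 by rewrite ffunE eqxx.
have T00 l : T l (i l) 0 = T l 0 0 * (i l == wbasis None l)%:R.
  rewrite ffunE /=.
  by case: (ord2_case (i l)) => ->; rewrite ?T0 /= ?mulr1 ?mulr0.
have T01 k : T k (i k) 1 = T k 0 1 * (i k == wbasis None k)%:R +
    T k 1 1 * (i k == wbasis (Some k) k)%:R.
  rewrite !ffunE eqxx /=; case: (ord2_case (i k)) => -> /=.
    by rewrite mulr1 mulr0 addr0.
  by rewrite mulr1 mulr0 add0r.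
have prodE (P : pred 'I_n) (o : option 'I_n) : 
    (forall l, P l -> wbasis o l = wbasis None l) ->
    \prod_(l | P l) T l (i l) (wbasis o l) =
    (\prod_(l | P l) T l 0 0) * \prod_(l | P l) (i l == wbasis None l)%:R.
  move=> oP; rewrite -big_split; apply: eq_bigr => l /oP->.
  by rewrite {1}ffunE T00.
transitivity (\sum_o y o * \prod_l T l (i l) (wbasis o l)).
  under eq_bigr => j _ do rewrite ffunE mulr_sumr.
  rewrite exchange_big; apply: eq_bigr => o _ /=.
  rewrite (bigD1 (wbasis o)) //= eqxx mulr1 [X in _ + X]big1.
    by rewrite addr0 mulrC.
  move=> j jo; by rewrite (negPf jo) !mulr0.
rewrite !big_option /= prodE // prodr_eq_indicator mulrDl mulrA -addrA.
congr (_ + _); rewrite mulr_suml -big_split; apply: eq_bigr => k _ /=.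
rewrite -!mulrA -mulrDr (bigD1 k) //= wk T01 prodE => [|l /wE //].
congr (_ * _).
rewrite -!prodr_eq_indicator [X in _ = _ * (_ * X) + _](bigD1 k) //=.
rewrite [X in _ = _ + _ * (_ * X)](bigD1 k) //= wk.
have -> : \prod_(l | l != k) (i l == wbasis (Some k) l)%:R =
    \prod_(l | l != k) (i l == wbasis None l)%:R :> C.
  by apply: eq_bigr => l /wE->.
by ring.
Qed.

Lemma phase_exists (C : numClosedFieldType) (z : C) :
  exists2 u : C, `|u| = 1 & u * z = `|z|.
Proof.
have [->|z0] := eqVneq z 0; first by exists 1; rewrite ?normr1 ?mulr0 ?normr0.
exists (`|z| / z); last by rewrite divfK.
by rewrite normrM normr_id normfV divff ?normr_eq0.
Qed.

Lemma unitarymx_diag2 (C : numClosedFieldType) (d : 'rV[C]_2) :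
  (forall i, `|d 0 i| = 1) -> diag_mx d \is unitarymx.
Proof.
move=> d1; apply/unitarymxP; rewrite tr_diag_mx map_diag_mx mulmx_diag.
apply/matrixP => i j; rewrite !mxE -normCK d1 expr1n.
by [].
Qed.

Lemma qr_mx22 (C : numClosedFieldType) (A : 'M[C]_2) :
  A \in unitmx -> exists U T : 'M[C]_2,
    [/\ U \is unitarymx, A = U *m T, T 1 0 = 0, T 0 0 != 0 & T 1 1 != 0].
Proof.
move=> Au; have dA : \det A != 0 by rewrite -unitfE -unitmxE.
pose N := sqrtC (`|A 0 0| ^+ 2 + `|A 1 0| ^+ 2).
have NN : N ^+ 2 = `|A 0 0| ^+ 2 + `|A 1 0| ^+ 2 by rewrite sqrtCK.
have N0 : N != 0.
  rewrite sqrtC_eq0 paddr_eq0 ?exprn_ge0 // !expf_eq0 /= !normr_eq0.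
  apply: contraNN dA => /andP[/eqP a0 /eqP c0].
  by rewrite det_mx22 a0 c0 mul0r mulr0 subrr.
have Nc : N^* = N.
  by apply: CrealP; rewrite ger0_real // sqrtC_ge0 addr_ge0 // exprn_ge0.
(* The first row is the normalized conjugate of the first column of [A]. The second row annihilates
   that column, so [Q *m A] is upper triangular. *)
pose Q : 'M[C]_2 := \matrix_(i, j)
  ((if i == 0 then (A j 0)^* else if j == 0 then - A 1 0 else A 0 0) / N).
have Qu : Q \is unitarymx.
  apply/unitarymxP; apply/matrixP => i j; rewrite !mxE !big_ord_recl big_ord0.
  have -> : lift ord0 ord0 = 1 :> 'I_2 by exact: val_inj.
  rewrite !mxE addr0.
  by case: (ord2_case i) => ->; case: (ord2_case j) => ->; rewrite /=
    !rmorphM !fmorphV /= ?rmorphN /= ?conjCK Nc; rewrite ?(mulr0n, mulr1n);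
    apply: (mulIf (expf_neq0 2 N0)); rewrite ?mul0r ?mul1r ?[RHS]NN ?normCK;
    field.
have QA10 : (Q *m A) 1 0 = 0.
  rewrite !mxE !big_ord_recl big_ord0.
  have -> : lift ord0 ord0 = 1 :> 'I_2 by exact: val_inj.
  by rewrite !mxE /=; field.
exists (Q^t*), (Q *m A); split=> //.
- by rewrite trmxC_unitary.
- by rewrite mulmxA -invmx_unitary // mulVmx ?mul1mx // unitarymx_unit.
- have : \det (Q *m A) != 0.
    by rewrite -unitfE -unitmxE unitmx_mul Au unitarymx_unit.
  rewrite det_mx22 QA10 mulr0 subr0; apply: contraNneq => ->.
  by rewrite mul0r.
- have : \det (Q *m A) != 0.
    by rewrite -unitfE -unitmxE unitmx_mul Au unitarymx_unit.
  rewrite det_mx22 QA10 mulr0 subr0; apply: contraNneq => ->.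
  by rewrite mulr0.
Qed.

Lemma W_type_LU_wvec (C : numClosedFieldType) (n : nat) (phi : qvector C n) :
  (0 < n)%N -> W_type phi ->
  exists y : option 'I_n -> C,
    [/\ LU_equiv phi (wvec y), 0 <= y None & forall k, 0 < y (Some k)].
Proof.
move=> n0 [_ [A [Au ->]]].
have /fin_all_exists[UT UTP] k : exists UT : 'M[C]_2 * 'M[C]_2,
    [/\ UT.1 \is unitarymx, A k = UT.1 *m UT.2, UT.2 1 0 = 0,
        UT.2 0 0 != 0 & UT.2 1 1 != 0].
  by have [U [T UT]] := qr_mx22 (Au k); exists (U, T).
have AE : A =1 (fun k => (UT k).1 *m (UT k).2) by move=> k; have [] := UTP k.
rewrite W_state_wvec (eq_local_op _ AE) -local_op_comp.
rewrite local_op_triangular_wvec => [|l]; last by have [] := UTP l.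
set y := (X in wvec X).
have y0 k : y (Some k) != 0.
  rewrite /y !mulf_neq0 //; last 2 first.
  - by have [] := UTP k.
  - by apply/prodf_neq0 => l _; have [] := UTP l.
  by rewrite invr_eq0 sqrtC_eq0 pnatr_eq0 -lt0n.
have [u u1 uE] := phase_exists (y None).
(* The phase [u] is spread evenly over the [n] factors: [a] on every |0> multiplies the coefficient
   of |0...0> by [a ^+ n = u]. The coefficient of e_k then picks up [a ^+ n.-1], and the phase [b k]
   on |1> makes it positive. *)
pose a := n.-root u.
have an : a ^+ n = u by rewrite rootCK.
have a1 : `|a| = 1.
  by apply/eqP; rewrite -(pexpr_eq1 n0) // -normrX an u1.
have /fin_all_exists[b bP] k : exists b : C, `|b| = 1 /\
    b * (y (Some k) * a ^+ n.-1) = `|y (Some k) * a ^+ n.-1|.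
  by have [b b1 bE] := phase_exists (y (Some k) * a ^+ n.-1); exists b.
pose D k : 'M[C]_2 := diag_mx (\row_i if i == 0 then a else b k).
have D00 k : D k 0 0 = a by rewrite !mxE.
have D11 k : D k 1 1 = b k by rewrite !mxE.
have D10 k : D k 1 0 = 0 by rewrite !mxE.
have D01 k : D k 0 1 = 0 by rewrite !mxE.
have prodD (k : 'I_n) : \prod_(l | l != k) D l 0 0 = a ^+ n.-1.
  under eq_bigr do rewrite D00.
  by rewrite prodr_const cardC1 card_ord.
have := local_op_triangular_wvec y D10; set y' := (X in _ = wvec X) => DE.
exists y'; split=> [||k].
- apply: LU_equiv_trans (_ : LU_equiv _ (wvec y)) _.
    by exists (fun k => (UT k).1); split=> // k; have [] := UTP k.
  apply: LU_equiv_sym; exists D; split=> // k; apply: unitarymx_diag2 => i.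
  by rewrite mxE; case: ifP => // _; have [] := bP k.
- rewrite /y' [X in _ + X]big1 ?addr0 => [|k _];
    last by rewrite D01 mul0r mulr0.
  under eq_bigr do rewrite D00.
  by rewrite prodr_const card_ord an mulrC uE.
- rewrite /y' D11 prodD mulrCA; have [_ ->] := bP k.
  by rewrite normr_gt0 mulf_neq0 // expf_neq0 // -normr_eq0 a1 oner_eq0.
Qed.

(** * Reduced density matrices of the normal form *)

Lemma sandwich_wvec (C : numClosedFieldType) (n : nat) (y : option 'I_n -> C)
    (G : 'I_n -> 'M[C]_2) :
  sandwich (wvec y) G = \sum_o \sum_o'
    (\prod_k G k (wbasis o k) (wbasis o' k)) * (y o * (y o')^*).
Proof.
(* Used twice: with [f] the conjugation for the inner sum, and with the identity for the outer
   one. *)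
have wE (F : qindex n -> C) (f : {rmorphism C -> C}) :
    \sum_i F i * f (wvec y i) = \sum_o F (wbasis o) * f (y o).
  under eq_bigr => i _ do rewrite ffunE rmorph_sum mulr_sumr.
  rewrite exchange_big; apply: eq_bigr => o _ /=.
  rewrite (bigD1 (wbasis o)) //= eqxx mulr1 big1 ?addr0 // => i io.
  by rewrite (negPf io) mulr0 rmorph0 mulr0.
rewrite /sandwich.
transitivity (\sum_(i : qindex n)
    (\sum_o' (\prod_k G k (i k) (wbasis o' k)) * (y o')^*) *
    wvec y i).
  apply: eq_bigr => i _.
  rewrite -(wE (fun j => \prod_k G k (i k) (j k)) Num.conj).
  rewrite mulr_suml; apply: eq_bigr => j _.
  by rewrite mulrAC mulrA.
rewrite (wE _ idfun); apply: eq_bigr => o _; rewrite mulr_suml.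
by apply: eq_bigr => o' _; rewrite mulrAC mulrA.
Qed.

(** [off_k] resets position [k] to 0, so two of the basis vectors agree off [k] exactly when [off_k]
    identifies their labels. *)
Lemma reduced_density_wvec (C : numClosedFieldType) (n : nat)
    (y : option 'I_n -> C) (k : 'I_n) (a b : 'I_2) :
  let off_k o := if o == Some k then None else o in
  reduced_density (wvec y) k a b =
  \sum_(o | wbasis o k == a)
    \sum_(o' | (wbasis o' k == b) && (off_k o == off_k o')) y o * (y o')^*.
Proof.
move=> off_k; rewrite reduced_densityE sandwich_wvec [RHS]big_mkcond.
apply: eq_bigr => o _.
have off_kk o1 : wbasis (off_k o1) k = 0.
  by rewrite ffunE /off_k; case: (eqVneq o1 (Some k)) => [|/negPf->].
have off_kE o1 l : l != k -> wbasis o1 l = wbasis (off_k o1) l.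
  rewrite /off_k; case: (o1 =P Some k) => [->|//] lk; rewrite !ffunE /=.
  by rewrite (inj_eq (@Some_inj _)) eq_sym (negPf lk).
have offE o' : \prod_(l | l != k) (wbasis o l == wbasis o' l)%:R =
    (off_k o == off_k o')%:R :> C.
  rewrite -(inj_eq (@wbasis_inj n)) -prodr_eq_indicator [RHS](bigD1 k) //=.
  rewrite !off_kk eqxx mul1r; apply: eq_bigr => l lk.
  by rewrite off_kE // [wbasis o' _]off_kE.
have prodE o' : \prod_l (if l == k then delta_mx a b else 1%:M)
      (wbasis o l) (wbasis o' l) =
    (wbasis o k == a)%:R *
    ((wbasis o' k == b)%:R * (off_k o == off_k o')%:R) :> C.
  rewrite (bigD1 k) //= eqxx mxE -offE mulrA -natrM mulnb; congr (_ * _).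
  by apply: eq_bigr => l /negPf->; rewrite mxE.
case: ifP => oa; last by rewrite big1 // => o' _; rewrite prodE oa !mul0r.
rewrite [RHS]big_mkcond; apply: eq_bigr => o' _; rewrite prodE oa mul1r.
by do 2!case: (_ == _); rewrite ?mulr1 ?mulr0 ?mul1r ?mul0r.
Qed.

(** The labels [None] and [Some k] are the only distinct ones whose basis vectors agree off [k]. So
    each diagonal entry is a sum of squared moduli, and each off-diagonal entry is a single
    product. *)
Lemma reduced_density_wvec_entries (C : numClosedFieldType) (n : nat)
    (y : option 'I_n -> C) (k : 'I_n) (rho := reduced_density (wvec y) k) :
  [/\ rho 0 0 = \sum_(o | o != Some k) `|y o| ^+ 2,
      rho 1 1 = `|y (Some k)| ^+ 2,
      rho 0 1 = y None * (y (Some k))^* &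
      rho 1 0 = y (Some k) * (y None)^*].
Proof.
have w1 o : (wbasis o k == 1) = (o == Some k) by rewrite ffunE; case: ifP.
have w0 o : (wbasis o k == 0) = (o != Some k) by rewrite ffunE; case: ifP.
have dis (i : option 'I_n) (P : pred (option 'I_n)) :
    (forall o, P o -> o = i) -> P i ->
    forall F, \sum_(o | P o) F o = F i :> C.
  move=> Pi iP F; rewrite (big_pred1 i) // => o /=.
  by apply/idP/eqP => [/Pi|->].
rewrite /rho !reduced_density_wvec; split.
- under eq_bigl do rewrite w0.
  apply: eq_bigr => o ok; rewrite (dis o) ?normCK // => [o'|].
    by rewrite w0 (negPf ok) => /andP[/negPf-> /eqP].
  by rewrite w0 ok eqxx.
- under eq_bigl do rewrite w1.
  rewrite big_pred1_eq (dis (Some k)) ?normCK // => [o'|].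
    by rewrite w1 => /andP[/eqP].
  by rewrite w1 !eqxx.
- under eq_bigl do rewrite w0.
  rewrite (bigD1 None) //= (dis (Some k)) => [|o'|]; last 2 first.
  + by rewrite w1 => /andP[/eqP].
  + by rewrite w1 !eqxx.
  rewrite big1 ?addr0 // => o /andP[ok o0]; rewrite big_pred0 // => o'.
  rewrite w1 (negPf ok).
  by have [_|//] := eqVneq o' (Some k); rewrite (negPf o0).
- under eq_bigl do rewrite w1.
  rewrite big_pred1_eq eqxx (dis None) // => [o'|].
    by rewrite w0 => /andP[/negPf-> /eqP].
  by rewrite w0.
Qed.

(** The product of the off-diagonal entries cancels the contribution of [y None] to the upper left
    entry. *)
Lemma det_reduced_density_wvec (C : numClosedFieldType) (n : nat)
    (y : option 'I_n -> C) (k : 'I_n) :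
  \det (reduced_density (wvec y) k) =
  `|y (Some k)| ^+ 2 *
  (\sum_l `|y (Some l)| ^+ 2 - `|y (Some k)| ^+ 2).
Proof.
have [e00 e11 e01 e10] := reduced_density_wvec_entries y k.
rewrite det_mx22 e00 e11 e01 e10.
have := big_option +%R (fun o => `|y o| ^+ 2); rewrite (bigD1 (Some k)) //=.
move/(canRL (addKr _)) => ->; rewrite !normCK; ring.
Qed.

Lemma tr_reduced_density_wvec (C : numClosedFieldType) (n : nat)
    (y : option 'I_n -> C) (k : 'I_n) :
  \tr (reduced_density (wvec y) k) = \sum_o `|y o| ^+ 2.
Proof.
have [e00 e11 _ _] := reduced_density_wvec_entries y k.
by rewrite tr_mx22 e00 e11 [RHS](bigD1 (Some k)) //= addrC.
Qed.

Lemma LU_equiv_char_poly (C : numClosedFieldType) (n : nat)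
    (phi psi : qvector C n) (k : 'I_n) :
  LU_equiv phi psi ->
  char_poly (reduced_density phi k) = char_poly (reduced_density psi k).
Proof.
move=> [U [Uu ->]]; rewrite reduced_density_local_unitary //.
by rewrite -invmx_unitary // char_poly_conjumx // unitarymx_unit.
Qed.

(** * The bipartite case *)

Definition pair_index (a b : 'I_2) : qindex 2 :=
  [ffun l => if l == 0 then a else b].

Lemma pair_indexK (i : qindex 2) : pair_index (i 0) (i 1) = i.
Proof. by apply/ffunP => l; rewrite ffunE; case: (ord2_case l) => ->. Qed.

Lemma sum_qindex2 (R : nmodType) (F : qindex 2 -> R) :
  \sum_i F i = \sum_a \sum_b F (pair_index a b).
Proof.
rewrite pair_big (reindex (fun p => pair_index p.1 p.2)) //=.
exists (fun i => (i 0, i 1)) => [[a b]|i] _ /=; last exact: pair_indexK.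
by rewrite !ffunE.
Qed.

(** This identifies a two-qubit vector with a matrix, on which local operators act by left
    multiplication and by right multiplication with a transpose. *)
Definition coeff_mx (C : numClosedFieldType) (phi : qvector C 2) : 'M[C]_2 :=
  \matrix_(a, b) phi (pair_index a b).

Lemma prod_ord2 (R : comPzSemiRingType) (F : 'I_2 -> R) :
  \prod_k F k = F 0 * F 1.
Proof.
rewrite !big_ord_recl big_ord0 mulr1.
by have -> : lift ord0 ord0 = 1 :> 'I_2 by exact: val_inj.
Qed.

Lemma reduced_density_coeff_mx (C : numClosedFieldType) (phi : qvector C 2) :
  reduced_density phi 0 = coeff_mx phi *m (coeff_mx phi)^t*.
Proof.
apply/matrixP => a b; rewrite reduced_densityE /sandwich sum_qindex2.
transitivity (\sum_c \sum_c' \sum_d \sum_d' ((c == a) && (d == b))%:R *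
  (c' == d')%:R * (phi (pair_index c c') * (phi (pair_index d d'))^*)).
  apply: eq_bigr => c _; apply: eq_bigr => c' _; rewrite sum_qindex2.
  apply: eq_bigr => d _; apply: eq_bigr => d' _.
  by rewrite prod_ord2 !ffunE !mxE.
rewrite (bigD1 a) //= [X in _ + X]big1 ?addr0 => [|c ca]; last first.
  do 3!(rewrite big1 // => ? _).
  by rewrite (negPf ca) !mul0r.
rewrite mxE; apply: eq_bigr => c' _.
rewrite (bigD1 b) //= [X in _ + X]big1 ?addr0.
  rewrite (bigD1 c') //= [X in _ + X]big1 ?addr0.
    by rewrite !eqxx !mul1r !mxE.
  by move=> d' /negPf dc; rewrite eq_sym dc mulr0 mul0r.
move=> d /negPf db; rewrite big1 // => d' _.
by rewrite db andbF !mul0r.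
Qed.

Lemma coeff_mx_local_op (C : numClosedFieldType) (A : 'I_2 -> 'M[C]_2)
    (phi : qvector C 2) :
  coeff_mx (local_op A phi) = A 0 *m coeff_mx phi *m (A 1)^T.
Proof.
apply/matrixP => a b; rewrite !mxE ffunE sum_qindex2 exchange_big.
apply: eq_bigr => d _; rewrite !mxE mulr_suml; apply: eq_bigr => c _.
by rewrite prod_ord2 !ffunE !mxE /= mulrAC.
Qed.

Lemma coeff_mx_inj (C : numClosedFieldType) : injective (@coeff_mx C).
Proof.
move=> phi psi /matrixP e; apply/ffunP => i.
by have := e (i 0) (i 1); rewrite !mxE pair_indexK.
Qed.

(* If M M' = U N N' U' (' the adjoint), then V = M^-1 U N is unitary and
   M = U N V'. *)
Lemma bipartite_LU_equiv (C : numClosedFieldType) (phi psi : qvector C 2) :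
  reduced_density phi 0 \in unitmx ->
  same_spectrum (reduced_density phi 0) (reduced_density psi 0) ->
  LU_equiv phi psi.
Proof.
rewrite !reduced_density_coeff_mx; set M := coeff_mx phi; set N := coeff_mx psi.
rewrite unitmx_mul => /andP[Mu _].
have normal (B : 'M[C]_2) : B *m B^t* \is normalmx.
  by apply/normalmxP; rewrite trmx_mul map_mxM trmxCK.
move=> /(normalmx_same_spectrum (normal M) (normal N))[U Uu e].
pose V := invmx M *m U *m N.
have Vu : V \is unitarymx.
  apply/unitarymxP; rewrite /V !trmx_mul !map_mxM !mulmxA.
  rewrite -(mulmxA _ N) -(mulmxA (invmx M) U) -(mulmxA (invmx M)) -e.
  rewrite mulmxA mulVmx // mul1mx -map_mxM -trmx_mul mulVmx //.
  by rewrite trmx1 map_mx1.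
have ME : M = U *m N *m V^t*.
  have -> : U *m N = M *m V by rewrite /V !mulmxA mulmxV // mul1mx.
  by rewrite mulmxtVK.
(* The second operator acts on coefficient matrices through its transpose, hence the outer [^T]. *)
exists (fun k => if k == 0 then U else (V^t*)^T); split=> [k|].
  by case: ifP => // _; rewrite trmx_unitary trmxC_unitary.
by apply: coeff_mx_inj; rewrite coeff_mx_local_op /= trmxK.
Qed.

(** * Determination of the normal form and conclusion *)

Local Open Scope complex_scope.

Lemma eq_char_poly_det (R : idomainType) (m : nat) (A B : 'M[R]_m) :
  char_poly A = char_poly B -> \det A = \det B.
Proof.
move=> /(congr1 (fun f : {poly R} => f`_0)); rewrite !char_poly_det.
by apply/mulfI; rewrite signr_eq0.
Qed.

Lemma eq_char_poly_tr (R : nzRingType) (m : nat) (A B : 'M[R]_m) :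
  (0 < m)%N -> char_poly A = char_poly B -> \tr A = \tr B.
Proof.
move=> m0 /(congr1 (fun f : {poly R} => f`_m.-1)).
by rewrite !char_poly_trace // => /oppr_inj.
Qed.

Lemma wvec_char_poly_inj (R : rcfType) (n : nat) (y z : option 'I_n -> R[i]) :
  (2 < n)%N -> 0 <= y None -> (forall k, 0 < y (Some k)) ->
  0 <= z None -> (forall k, 0 < z (Some k)) ->
  (forall k, char_poly (reduced_density (wvec y) k) =
             char_poly (reduced_density (wvec z) k)) ->
  y =1 z.
Proof.
move=> n2 yN yS zN zS e.
(* The order on [R[i]] is only partial, so the squared moduli are transported to [R], where the
   uniqueness result for real sums applies. *)
have [p pE] : exists p : (option 'I_n -> R[i]) -> 'I_n -> R,
    forall x k, (p x k)%:C = `|x (Some k)| ^+ 2.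
  exists (fun x k => complex.Re (`|x (Some k)| ^+ 2)) => x k.
  by rewrite RRe_real // ger0_real // exprn_ge0.
have detE x k : (p x k * (\sum_l p x l - p x k))%:C =
    \det (reduced_density (wvec x) k).
  rewrite det_reduced_density_wvec rmorphM rmorphB rmorph_sum /= pE.
  by congr (_ * (_ - _)); apply: eq_bigr => l _; rewrite pE.
have p0 x k : 0 < x (Some k) -> 0 < p x k.
  by move=> x0; rewrite -ltcR pE exprn_gt0 // normr_gt0 gt_eqF.
have pyz : p y =1 p z.
  apply: sum_complement_inj => // [k|k|k]; do ?exact: p0.
  apply: complexI; rewrite !detE.
  exact: eq_char_poly_det (e k).
have yzS k : y (Some k) = z (Some k).
  apply: (@pexpIrn _ 2) => //; rewrite ?nnegrE ?ltW //.
  by rewrite -[y _]gtr0_norm // -[z _]gtr0_norm // -!pE pyz.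
move=> [k|]; first exact: yzS.
(* Any one index will do: the trace is the sum of all squared moduli, and the terms other than that
   of [None] already agree. *)
have k := Ordinal (ltnW (ltnW n2)).
have := eq_char_poly_tr (isT : (0 < 2)%N) (e k).
rewrite !tr_reduced_density_wvec !big_option; under eq_bigr do rewrite yzS.
move/addIr; rewrite !ger0_norm // => yz2.
by apply: (@pexpIrn _ 2) => //; rewrite nnegrE.
Qed.

Theorem theorem1 (R : realType) (n : nat) (hn : (2 <= n)%N)
    (phi psi : qvector R[i] n) (hphi : W_type phi) (hpsi : W_type psi)
    (hspec : forall k : 'I_n,
      same_spectrum (reduced_density phi k) (reduced_density psi k)) :
  LU_equiv phi psi.
Proof.
have [y [phiy yN yS]] := W_type_LU_wvec (ltnW hn) hphi.
have [z [psiz zN zS]] := W_type_LU_wvec (ltnW hn) hpsi.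
have [n2|n2] := ltnP 2 n; last first.
  have n2E : n = 2 by apply/eqP; rewrite eqn_leq n2.
  subst n; apply: bipartite_LU_equiv (hspec 0).
  (* Invertibility of the first reduced matrix: its determinant is the product of two positive
     squared moduli. *)
  rewrite unitmxE unitfE (eq_char_poly_det (LU_equiv_char_poly 0 phiy)).
  rewrite det_reduced_density_wvec.
  rewrite (bigD1 0) //= [X in _ * X]addrC addKr big_mkcond /=.
  rewrite mulf_neq0 ?expf_neq0 ?normr_eq0 ?gt_eqF //.
  rewrite big_ord_recl /= add0r big_ord_recl big_ord0 addr0 exprn_gt0 //.
  by rewrite normr_gt0 gt_eqF.
apply: (LU_equiv_trans phiy); apply: LU_equiv_sym.
suff -> : wvec y = wvec z by [].
apply/ffunP => i; rewrite !ffunE; apply: eq_bigr => o _; congr (_ * _).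
apply: (wvec_char_poly_inj n2 yN yS zN zS) => k.
rewrite -(LU_equiv_char_poly k phiy) -(LU_equiv_char_poly k psiz).
exact: same_spectrum_char_poly.
Qed.
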